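(* There exists an absolute positive constant $c$ such that the following holds. Let $D\ge1$ be an integer, let $\mathcal{A}$ be a class of measurable subsets of $\mathcal{X}$ satisfying property $(\mathrm{A}_{N,D})$ for every integer $N$ such that $N\ge4D$, and let $S=\{\mathbb{1}_A: A\in\mathcal{A}\}$. Let $h\in[0,1)$. Then $$R_n(h,S)\ge c(1-h)\frac{D}{nh}\left[1+\log\left(\frac{nh^2}{D}\right)\right],$$ provided that $h\ge\sqrt{D/n}$, where $R_n(h,S)=\inf_{\hat s\in S}\sup_{P\in\mathcal{P}(h,S)}\mathbb{E}[\ell(s^*,\hat s)]$ is the minimax risk over $\mathcal{P}(h,S)$.
   Context: Binary classification setting: one observes $n$ independent copies $(X_1,Y_1),\dots,(X_n,Y_n)$ of a pair $(X,Y)$ with distribution $P$ on $\mathcal{X}\times\{0,1\}$, $\mathcal{X}$ a measurable space. A classifier is a measurable map $t:\mathcal{X}\to\{0,1\}$; $\eta(x)=P[Y=1\mid X=x]$ is the regression function, $s^*(x)=\mathbb{1}_{\eta(x)\ge1/2}$ is the Bayes classifier (both depend on $P$), and $\ell(s^*,t)=P(Y\ne t(X))-P(Y\ne s^*(X))$. $\mathcal{P}(h,S)$ is the set of probability distributions $P$ on $\mathcal{X}\times\{0,1\}$ such that $|2\eta(x)-1|\ge h$ for all $x\in\mathcal{X}$ and $s^*\in S$. In the definition of $R_n(h,S)$ the infimum is over all estimators $\hat s$ based on the $n$-sample and taking their values in $S$; the expectation is under the sample having distribution $P^{\otimes n}$. Property $(\mathrm{A}_{N,D})$: there exist $N$ (distinct)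 points $x_1,\dots,x_N$ of $\mathcal{X}$ such that the trace $\{A\cap\{x_1,\dots,x_N\}: A\in\mathcal{A}\}$ contains all the subsets of $\{x_1,\dots,x_N\}$ with cardinality $D$. *)

(* Defs.v *)
From HB Require Import structures.
From mathcomp Require Import all_boot all_order all_algebra.
From mathcomp Require Import all_classical all_reals all_analysis.
From mathcomp Require Import measurable_realfun.
Set Implicit Arguments.
Unset Strict Implicit.
Unset Printing Implicit Defensive.
Import Order.TTheory GRing.Theory Num.Theory.
Local Open Scope classical_set_scope.
Local Open Scope ring_scope.
Local Open Scope ereal_scope.

Section product_probability.
Context {R : realType} {d1 d2 : measure_display}.
Context {T1 : measurableType d1} {T2 : measurableType d2}.
Context (P : probability T1 R) (Q : probability T2 R).

Definition product_probability : set (T1 * T2) -> \bar R := P \x Q.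

HB.instance Definition _ := Measure.on product_probability.

Let product_probability_setT : product_probability setT = 1.
Proof.
rewrite -setXTT [LHS]product_measure1E//.
by rewrite [X in X * _]probability_setT [X in _ * X]probability_setT mule1.
Qed.

HB.instance Definition _ := Measure_isProbability.Build _ _ _
  product_probability product_probability_setT.

End product_probability.

Section sample_law.
Context {R : realType} {d : measure_display} {Z : measurableType d}.

Definition cons_pair n (p : Z * n.-tuple Z) : n.+1.-tuple Z :=
  [tuple of p.1 :: p.2].

Lemma measurable_cons_pair n : measurable_fun setT (@cons_pair n).
Proof. exact: measurable_cons. Qed.

HB.instance Definition _ n :=
  isMeasurableFun.Build _ _ _ _ (@cons_pair n) (@measurable_cons_pair n).

(* The n-fold product measure, by iterating the binary product of the
   library; [sample_law_box] characterizes it. *)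
Fixpoint sample_law (P : probability Z R) n : probability (n.-tuple Z) R :=
  match n with
  | 0 => dirac [tuple]
  | m.+1 => distribution (product_probability P (sample_law P m)) (@cons_pair m)
  end.

Lemma measurable_box n (A : 'I_n -> set Z) : (forall i, measurable (A i)) ->
  measurable [set z : n.-tuple Z | forall i, A i (tnth z i)].
Proof.
move=> mA.
rewrite (_ : [set z | _] =
  \bigcap_(i in [set: 'I_n]) ((@tnth n Z ^~ i) @^-1` A i)); last first.
  by apply/seteqP; split => [z Az i _|z Az i]; exact: Az.
apply: fin_bigcap_measurable => // i _; rewrite -[X in measurable X]setTI.
exact: (@measurable_tnth _ Z n i measurableT _ (mA i)).
Qed.

Lemma sample_law_box (P : probability Z R) n (A : 'I_n -> set Z) :
  (forall i, measurable (A i)) ->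
  sample_law P n [set z | forall i, A i (tnth z i)] = \prod_(i < n) P (A i).
Proof.
elim: n A => [|n IH] A mA.
  by rewrite big_ord0/= diracE mem_set// => -[].
rewrite big_ord_recl -IH//= /distribution /pushforward.
rewrite -product_measure1E//;
  last exact: (@measurable_box n (fun i => A (lift ord0 i))).
congr (_ _); apply/seteqP; split => -[x z]/=.
  by move=> Az; split=> [|i]; [exact: (Az ord0)|have := Az (lift ord0 i); rewrite tnthS].
move=> [Ax Az] i; case: (unliftP ord0 i) => [j ->|->//].
by rewrite tnthS; exact: Az.
Qed.

End sample_law.

Section classification.
Context {R : realType} {d : measure_display} {T : measurableType d}.
Implicit Types (P : probability (T * bool)%type R) (eta : T -> R).
Implicit Types (t : T -> bool) (S : set (T -> bool)) (h : R).

Definition indicator_class (calA : set (set T)) : set (T -> bool) :=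
  [set (fun x => x \in A) | A in calA].

Definition property_A (calA : set (set T)) (N D : nat) : Prop :=
  exists2 x : 'I_N -> T, injective x &
    forall B, B `<=` range x -> (B #= `I_D)%card ->
      [set A `&` range x | A in calA] B.

(* A function [eta] with [eta X] a version of the conditional probability
   that [Y = 1] given [X]; it is determined by [P] only almost everywhere. *)
Definition regression_function P eta : Prop :=
  [/\ measurable_fun setT eta,
      forall x, (0 <= eta x <= 1)%R &
      forall B, measurable B ->
        P [set z | B z.1 /\ z.2 = true] = \int[P]_(z in [set z | B z.1]) (eta z.1)%:E].

Definition bayes eta : T -> bool := fun x => (2^-1 <= eta x)%R.

Definition error P t : \bar R := P [set z | z.2 != t z.1].

Definition loss P s t : \bar R := error P t - error P s.

(* Membership of [P] in the class P(h, S), witnessed by the version [eta] of its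
   regression function. *)
Definition margin_class h S P eta : Prop :=
  [/\ regression_function P eta,
      forall x, (h <= `|2 * eta x - 1|)%R & S (bayes eta)].

(* The measurability clause says that the prediction error of [shat] is a random
   variable for every [P], so that its expectation makes sense; it holds as soon
   as [(z, x) |-> shat z x] is jointly measurable. *)
Definition estimator n S (shat : n.-tuple (T * bool) -> T -> bool) : Prop :=
  (forall z, S (shat z)) /\
  (forall P, measurable_fun setT (error P \o shat)).

(* [bayes eta] has minimal error among measurable classifiers, for any version
   [eta] of the regression function of [P]; hence [loss P (bayes eta) t] does not
   depend on the version, and the supremum over pairs [(P, eta)] is a
   supremum over [P]. *)
Definition minimax_risk n h S : \bar R :=
  ereal_inf [set
    ereal_sup [set \int[sample_law Peta.1 n]_z loss Peta.1 (bayes Peta.2) (shat z)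
              | Peta in [set Peta | margin_class h S Peta.1 Peta.2]]
    | shat in @estimator n S].

End classification.

(* Main.v *)
From HB Require Import structures.
Require Import Defs.
From mathcomp Require Import all_boot all_order all_algebra.
From mathcomp Require Import all_classical all_reals all_analysis.
From mathcomp Require Import measurable_realfun ring lra.
Import Order.TTheory GRing.Theory Num.Theory.
Local Open Scope classical_set_scope.
Local Open Scope ring_scope.

(** A Bayesian lower bound.  Take [D * K] points in [D] blocks of [K] points,
    all of mass [1 / (D K)], and choose uniformly [th : [D] -> [K]]; let
    [eta = (1 + h) / 2] at the point [th j] of each block [j], and [(1 - h) / 2]
    at the other points.  The excess risk is [h / (D K)] times the number of
    misclassified points, so each block that is not recovered exactly costs at
    least [h / (D K)].  Given [th] outside block [j], compare the [K] candidate
    laws with the one where [eta = (1 - h) / 2] on all of block [j]: the second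
    moment of the likelihood ratio is
    [chi = (1 + 4 h^2 / (D K (1 - h^2)))^n], and by Cauchy-Schwarz the mean
    probability of recovering block [j] is at most [sqrt (chi / K)].  When
    [chi <= K / 4] the risk is thus at least [h / (2 K)]; the smallest such [K] is
    of order [u / ((1 - h) (1 + ln u))] with [u = n h^2 / D]. *)

(** * Sums over tuples and over finite functions *)

(** Stated for any commutative monoid law, as it serves both for finite sums in a ring and for sums
    of extended reals. *)
Lemma big_tuple_cons (V : Type) (idx : V) (op : Monoid.com_law idx)
    (I : finType) n (F : n.+1.-tuple I -> V) :
  \big[op/idx]_w F w = \big[op/idx]_i \big[op/idx]_(w : n.-tuple I) F [tuple of i :: w].
Proof.
rewrite pair_big /=.
rewrite (reindex (fun u : I * n.-tuple I => [tuple of u.1 :: u.2])) //=.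
exists (fun w => (thead w, [tuple of behead w])) => [[i w] _|w _] /=.
  by rewrite theadE; congr pair; apply: val_inj.
by rewrite -tuple_eta.
Qed.

Lemma sum_tuple_prod (V : comPzRingType) (I : finType) n (F : I -> V) :
  \sum_(w : n.-tuple I) \prod_(o <- w) F o = (\sum_i F i) ^+ n.
Proof.
elim: n => [|n IH].
  rewrite (bigD1 [tuple]) //= big_nil [X in _ + X]big1 ?addr0 // => w.
  by rewrite tuple0 => /eqP.
rewrite big_tuple_cons exprS mulr_suml; apply: eq_bigr => i _.
by rewrite -IH mulr_sumr; apply: eq_bigr => w _; rewrite /= big_cons.
Qed.

(** For each fixed [c], adding [c] modulo [k.+1] at coordinate [j] permutes the functions [th]. This
    averages over [th j] with the other coordinates frozen. *)
Lemma sum_ffun_shift (V : pzSemiRingType) (J : finType) k (j : J)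
    (G : {ffun J -> 'I_k.+1} -> V) :
  k.+1%:R * \sum_th G th =
  \sum_(th : {ffun J -> 'I_k.+1}) \sum_(c < k.+1)
    G (th + [ffun i => if i == j then c else 0]).
Proof.
rewrite exchange_big /= -[X in X%:R](card_ord k.+1) -sum1_card natr_sum mulr_suml.
by apply: eq_bigr => c _; rewrite mul1r (reindex_inj (addIr [ffun i => if i == j then c else 0])).
Qed.

(** * The Bayesian bound on a finite grid of points *)

Section finite_problem.
Context {R : realFieldType} {D k n : nat} (h : R).
Implicit Types (th : {ffun 'I_D -> 'I_k.+1}) (i : 'I_D * 'I_k.+1).
Implicit Types (o : 'I_D * 'I_k.+1 * bool) (j : 'I_D).

Definition selected th i : bool := th i.1 == i.2.

Definition label_weight (a b : bool) : R :=
  (D * k.+1)%:R^-1 * (if b == a then (1 + h) / 2 else (1 - h) / 2).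

Definition weight th o : R := label_weight (selected th o.1) o.2.

(* The reference law: block [j] carries the low value of [eta] everywhere, so
   this does not depend on [th j]. *)
Definition weight_off th j o : R :=
  label_weight ((o.1.1 != j) && selected th o.1) o.2.

Definition likelihood th (w : n.-tuple ('I_D * 'I_k.+1 * bool)) : R :=
  \prod_(o <- w) weight th o.

Definition finite_loss th (t : 'I_D * 'I_k.+1 -> bool) : R :=
  (D * k.+1)%:R^-1 * h * \sum_i (t i != selected th i)%:R.

Context (D_gt0 : (0 < D)%N) (h01 : 0 < h < 1).

Let m_gt0 : 0 < (D * k.+1)%:R :> R. Proof. by rewrite ltr0n muln_gt0 D_gt0. Qed.

Lemma label_weight_gt0 a b : 0 < label_weight a b.
Proof.
rewrite mulr_gt0 ?invr_gt0//; case/andP: h01 => h0 h1.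
by case: ifP => _; lra.
Qed.

Lemma sum_label_weight a : \sum_b label_weight a b = (D * k.+1)%:R^-1.
Proof.
rewrite big_bool /label_weight; move: (D * k.+1)%:R m_gt0 => m m0.
by case: a => /=; field; rewrite gt_eqF. Qed.

Lemma sum_weight th : \sum_o weight th o = 1.
Proof.
rewrite -(pair_big xpredT xpredT (fun i b => weight th (i, b))) /=.
rewrite (eq_bigr (fun=> (D * k.+1)%:R^-1)) => [|i _]; last first.
  exact: (sum_label_weight (selected th i)).
by rewrite sumr_const card_prod !card_ord -[LHS]mulr_natr mulVf // gt_eqF.
Qed.

Lemma sum_weight_off th j : \sum_o weight_off th j o = 1.
Proof.
rewrite -(pair_big xpredT xpredT (fun i b => weight_off th j (i, b))) /=.
rewrite (eq_bigr (fun=> (D * k.+1)%:R^-1)) => [|i _]; last first.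
  exact: (sum_label_weight ((i.1 != j) && selected th i)).
by rewrite sumr_const card_prod !card_ord -[LHS]mulr_natr mulVf // gt_eqF.
Qed.

(** The two laws differ only at the point [(j, th j)]; every other point contributes its mass
    [1 / m], where [m = D * k.+1]. That point contributes [(1 + 3 h^2) / (m (1 - h^2))], which
    exceeds [1 / m] by [4 h^2 / (m (1 - h^2))]. *)
Lemma chi2_weight th j :
  \sum_o weight th o ^+ 2 / weight_off th j o =
  1 + 4 * h ^+ 2 / ((D * k.+1)%:R * (1 - h ^+ 2)).
Proof.
case/andP: h01 => h0 h1.
rewrite -(pair_big xpredT xpredT (fun i b => weight th (i, b) ^+ 2 / weight_off th j (i, b))) /=.
have E i : i != (j, th j) ->
    \sum_b weight th (i, b) ^+ 2 / weight_off th j (i, b) = (D * k.+1)%:R^-1.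
  move=> ij; rewrite -(sum_label_weight (selected th i)); apply: eq_bigr => b _.
  rewrite /weight /weight_off /=.
  suff -> : (i.1 != j) && selected th i = selected th i.
    by rewrite expr2 mulfK // gt_eqF // label_weight_gt0.
  have [ij1|//] := eqVneq i.1 j; move: ij; rewrite /selected ij1.
  by case: i ij1 => i1 i2 /= ->; rewrite xpair_eqE eqxx /= eq_sym => /negbTE ->.
rewrite (bigD1 (j, th j)) //= (eq_bigr _ (fun i => E i)) sumr_const.
rewrite cardC1 card_prod !card_ord big_bool /weight /weight_off /selected /= !eqxx /=.
have -> : (D * k.+1)%:R^-1 *+ (D * k.+1).-1 = 1 - (D * k.+1)%:R^-1 :> R.
  rewrite -[LHS]mulr_natr -subn1 natrB ?muln_gt0 ?D_gt0 // mulrBr mulVf ?gt_eqF //.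
  by rewrite mulr1.
rewrite /label_weight /=; move: (D * k.+1)%:R m_gt0 => m m0.
field.
by rewrite !gt_eqF //; nra.
Qed.

Lemma likelihood_ge0 th w : 0 <= likelihood th w.
Proof. by apply: prodr_ge0 => o _; rewrite ltW // label_weight_gt0. Qed.

Lemma sum_likelihood th : \sum_w likelihood th w = 1.
Proof. by rewrite sum_tuple_prod sum_weight expr1n. Qed.

Context (chi : (1 + 4 * h ^+ 2 / ((D * k.+1)%:R * (1 - h ^+ 2))) ^+ n <= k.+1%:R / 4).

Context (t : n.-tuple ('I_D * 'I_k.+1 * bool) -> 'I_D * 'I_k.+1 -> bool).

Definition block_ok j (c : 'I_k.+1) w := [forall l, t w (j, l) == (c == l)].

(** A prediction on block [j] singles out at most one point, so at most one candidate fits it. The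
    offset [e] is the one that [sum_ffun_shift] produces. *)
Lemma sum_block_ok_le1 j w (e : 'I_k.+1) :
  \sum_(c < k.+1) (block_ok j (e + c) w)%:R <= 1 :> R.
Proof.
case: (pickP (fun c => block_ok j (e + c) w)) => [c0 /forallP ok0|no]; last first.
  by rewrite big1 ?ler01// => c _; rewrite no.
rewrite (bigD1 c0) //= big1 ?addr0 ?lern1 ?leq_b1// => c cc0.
suff /negbTE -> : ~~ block_ok j (e + c) w by [].
apply: contra cc0 => /forallP ok.
have := eqP (ok0 (e + c)); rewrite (eqP (ok _)) eqxx => /esym/eqP.
by move/addrI => ->.
Qed.

(** Under the reference law the sample says nothing about [th j], so the mean success probability is
    at most [1 / K], where [K = k.+1]. Changing to the true law gives at most
    [(K / 4) / K + (K / 4) / K = 1 / 2], the second term coming from [chi]. *)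
Lemma block_success j :
  \sum_th \sum_w likelihood th w * (block_ok j (th j) w)%:R <=
  #|{ffun 'I_D -> 'I_k.+1}|%:R / 2.
Proof.
pose Q th (w : n.-tuple _) : R := \prod_(o <- w) weight_off th j o.
have Q_gt0 th w : 0 < Q th w by apply: prodr_gt0 => o _; exact: label_weight_gt0.
have K0 : 0 < k.+1%:R :> R by rewrite ltr0n.
(* [L <= lam Q + L^2 / (4 lam Q)] with [lam = K / 4] replaces Cauchy-Schwarz. *)
have amgm th w : likelihood th w * (block_ok j (th j) w)%:R <=
    k.+1%:R / 4 * (Q th w * (block_ok j (th j) w)%:R)
    + likelihood th w ^+ 2 / Q th w / k.+1%:R.
  have := Q_gt0 th w; have := likelihood_ge0 th w.
  set L := likelihood th w; set q := Q th w => L0 q0.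
  have dq : 0 <= L ^+ 2 / q / k.+1%:R by rewrite !divr_ge0 ?exprn_ge0// ltW.
  case: block_ok; rewrite ?mulr0 ?mulr1 ?add0r//.
  rewrite -subr_ge0.
  have -> : k.+1%:R / 4 * q + L ^+ 2 / q / k.+1%:R - L =
     (k.+1%:R * q / 2 - L) ^+ 2 / (q * k.+1%:R).
    by move: (k.+1%:R) K0 => K K0; field; rewrite !gt_eqF.
  by rewrite divr_ge0 ?sqr_ge0// ltW// mulr_gt0.
(* The second moment is multiplicative over independent observations, hence the [n]-th power of its
   value for one observation. *)
have chiQ th : \sum_w likelihood th w ^+ 2 / Q th w <= k.+1%:R / 4.
  apply: le_trans chi; rewrite -(chi2_weight th j) -sum_tuple_prod.
  rewrite le_eqVlt; apply/orP; left; apply/eqP; apply: eq_bigr => w _.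
  by rewrite big_split prodfV prodrXl.
(* Shifting [th j] leaves [Q] unchanged, so only the successes are summed over the [K] shifts, and
   [sum_block_ok_le1] bounds them by 1. *)
have QE : \sum_th \sum_w Q th w * (block_ok j (th j) w)%:R <=
    #|{ffun 'I_D -> 'I_k.+1}|%:R / k.+1%:R.
  rewrite ler_pdivlMr// mulrC (sum_ffun_shift _ _ _ j) -sum1_card natr_sum.
  apply: ler_sum => th _; rewrite exchange_big /=.
  rewrite -[leRHS](expr1n _ n) -[in leRHS](sum_weight_off th j) -sum_tuple_prod.
  apply: ler_sum => w _; rewrite -[leRHS]mulr1.
  apply: le_trans (ler_wpM2l (ltW (Q_gt0 th w)) (sum_block_ok_le1 j w (th j))).
  rewrite mulr_sumr le_eqVlt; apply/orP; left; apply/eqP; apply: eq_bigr => c _.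
  rewrite !ffunE eqxx; congr (_ * _); rewrite /Q; apply: eq_bigr => o _.
  rewrite /weight_off /selected !ffunE; case: eqP => //= _; by rewrite addr0.
apply: (@le_trans _ _ (\sum_th (k.+1%:R / 4 * (\sum_w Q th w * (block_ok j (th j) w)%:R)
    + 4^-1))).
  apply: ler_sum => th _; rewrite mulr_sumr.
  apply: (@le_trans _ _ (\sum_w (k.+1%:R / 4 * (Q th w * (block_ok j (th j) w)%:R)
    + likelihood th w ^+ 2 / Q th w / k.+1%:R))).
    by apply: ler_sum => w _; exact: amgm.
  rewrite big_split lerD2l -mulr_suml ler_pdivrMr//.
  by apply: le_trans (chiQ th) _; rewrite mulrC.
rewrite big_split sumr_const -mulr_sumr -[X in _ + X <= _]mulr_natr /=.
apply: (@le_trans _ _ (k.+1%:R / 4 * (#|{ffun 'I_D -> 'I_k.+1}|%:R / k.+1%:R)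
   + 4^-1 * #|{ffun 'I_D -> 'I_k.+1}|%:R)).
  by rewrite lerD2r ler_wpM2l// divr_ge0// ltW.
rewrite le_eqVlt; apply/orP; left; apply/eqP.
by move: (k.+1%:R) K0 => K K0; field; rewrite gt_eqF.
Qed.

(** Each of the [D] blocks is missed with mean probability at least [1 / 2], at a cost of at least
    [h / (D K)]. Some [th] does no better than the average. *)
Lemma finite_lower_bound :
  exists th, h / (2 * k.+1%:R) <= \sum_w likelihood th w * finite_loss th (t w).
Proof.
case/andP: h01 => h0 h1.
pose M : R := #|{ffun 'I_D -> 'I_k.+1}|%:R.
have K0 : 0 < k.+1%:R :> R by rewrite ltr0n.
have D0 : 0 < D%:R :> R by rewrite ltr0n.
have lossP th w : (D * k.+1)%:R^-1 * h * \sum_j (1 - (block_ok j (th j) w)%:R)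
    <= finite_loss th (t w).
  rewrite /finite_loss ler_pM2l ?mulr_gt0 ?invr_gt0//.
  rewrite (eq_bigr (fun i => (t w (i.1, i.2) != selected th i)%:R)) => [|[]//].
  rewrite -(pair_big xpredT xpredT (fun j l => (t w (j, l) != selected th (j, l))%:R)) /=.
  apply: ler_sum => j _; have [_|] := boolP (block_ok j (th j) w).
    by rewrite subrr sumr_ge0.
  rewrite negb_forall => /existsP[l tl].
  by rewrite subr0 (bigD1 l) //= /selected /= tl lerDl sumr_ge0.
have sumP : M * (h / (2 * k.+1%:R)) <=
    \sum_th \sum_w likelihood th w * finite_loss th (t w).
  apply: (@le_trans _ _ (\sum_th \sum_w likelihood th w *
      ((D * k.+1)%:R^-1 * h * \sum_j (1 - (block_ok j (th j) w)%:R)))); last first.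
    by apply: ler_sum => th _; apply: ler_sum => w _; rewrite ler_wpM2l// likelihood_ge0.
  have -> : \sum_th \sum_w likelihood th w *
      ((D * k.+1)%:R^-1 * h * \sum_j (1 - (block_ok j (th j) w)%:R)) =
    (D * k.+1)%:R^-1 * h * \sum_j (M - \sum_th \sum_w likelihood th w * (block_ok j (th j) w)%:R).
    under eq_bigr => th _.
      under eq_bigr do rewrite mulrCA mulr_sumr.
      rewrite -mulr_sumr exchange_big /=.
      over.
    rewrite /= -mulr_sumr exchange_big /=; congr (_ * _); apply: eq_bigr => j _.
    rewrite /M -sum1_card natr_sum -sumrB; apply: eq_bigr => th _.
    by rewrite -[X in X - _](sum_likelihood th) -sumrB; apply: eq_bigr => w _; rewrite mulrBr mulr1.
  apply: (@le_trans _ _ ((D * k.+1)%:R^-1 * h * \sum_(j < D) (M / 2))).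
    rewrite sumr_const card_ord natrM -[X in _ <= _ * X]mulr_natr.
    rewrite le_eqVlt; apply/orP; left; apply/eqP.
    by move: (k.+1%:R) D%:R K0 D0 => K d K0 d0; field; rewrite !gt_eqF.
  rewrite ler_pM2l ?mulr_gt0 ?invr_gt0//; apply: ler_sum => j _.
  by have := block_success j; rewrite -/M; lra.
have [/existsP[th Hth]|] := boolP [exists th,
    h / (2 * k.+1%:R) <= \sum_w likelihood th w * finite_loss th (t w)].
  by exists th.
rewrite negb_exists => /forallP no; exfalso.
move: sumP; apply/negP; rewrite -ltNge /M -sum1_card natr_sum mulr_suml.
(* A strict inequality between sums needs a nonempty index set; the zero function is a witness. *)
apply: ltr_sum => [|th _]; first by apply/hasP; exists 0; rewrite ?mem_index_enum.
by rewrite mul1r ltNge.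
Qed.

End finite_problem.

(** * Finitely supported laws and their samples *)

Section finitely_supported_law.
Context {R : realType} {d : measure_display} {Z : measurableType d} {I : finType}.
Implicit Types (P : probability Z R) (q : I -> R) (x : I -> Z).
Local Open Scope ereal_scope.

(** Phrased with integrals, so that neither measurability of singletons nor injectivity of [x] is
    required. *)
Definition finitely_supported P q x :=
  forall f : Z -> \bar R, measurable_fun [set: _] f -> (forall z, 0 <= f z) ->
    \int[P]_z f z = \sum_i (q i)%:E * f (x i).

Lemma finitely_supported_exists q x :
  (forall i, 0 <= q i)%R -> (\sum_i q i = 1)%R -> exists P, finitely_supported P q x.
Proof.
move=> q0 q1.
(* Total mass 1 forces [I] to be nonempty; [i0] is then the default value of [nth] in the
   enumeration of the Dirac masses. *)
have [i0 _|no] := pickP I; last first.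
  by move/eqP: q1; rewrite big_pred0 // eq_sym oner_eq0.
pose m_ k : {measure set Z -> \bar R} :=
  mscale (NngNum (q0 (nth i0 (enum I) k))) (dirac (x (nth i0 (enum I) k))).
pose mu : {measure set Z -> \bar R} := msum m_ #|I|.
have mu_int (f : Z -> \bar R) : measurable_fun [set: _] f -> (forall z, 0 <= f z) ->
    \int[mu]_z f z = \sum_i (q i)%:E * f (x i).
  move=> mf f0; rewrite ge0_integral_measure_sum//.
  transitivity (\sum_(k < #|I|) (q (nth i0 (enum I) k))%:E * f (x (nth i0 (enum I) k))).
    apply: eq_bigr => k _.
    by rewrite ge0_integral_mscale//= integral_dirac// diracT mul1e.
  rewrite -(big_mkord xpredT (fun k => (q (nth i0 (enum I) k))%:E * f (x (nth i0 (enum I) k)))).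
  by rewrite cardE -(big_nth i0 xpredT (fun i => (q i)%:E * f (x i))) big_enum.
have muT : mu setT = 1.
  rewrite -[LHS]mul1e -(@integral_cst _ _ _ mu _ measurableT 1) mu_int//.
  by under eq_bigr do rewrite mule1; rewrite sumEFin q1.
pose P : probability Z R := HB.pack_for (probability Z R) (Measure.sort mu)
  (Measure.class mu) (Measure_isProbability.Build _ _ _ mu muT).
by exists P.
Qed.

Lemma finitely_supportedE P q x U : finitely_supported P q x -> measurable U ->
  P U = (\sum_i q i * (x i \in U)%:R)%:E.
Proof.
move=> Pq mU; rewrite -[X in P X]setIT -integral_indic// Pq//.
- by rewrite -sumEFin; apply: eq_bigr => i _; rewrite indicE -EFinM.
- exact/measurable_EFinP/measurable_indic.
Qed.

(** By induction on [n]: Tonelli's theorem splits off the first observation, as [big_tuple_cons]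
    does for the finite sum. *)
Lemma integral_sample_law P q x n (f : n.-tuple Z -> \bar R) :
  finitely_supported P q x -> (forall i, 0 <= q i)%R ->
  measurable_fun [set: _] f -> (forall z, 0 <= f z) ->
  \int[sample_law P n]_z f z =
  \sum_(w : n.-tuple I) (\prod_(i <- w) q i)%:E * f (map_tuple x w).
Proof.
move=> Pq q0; elim: n f => [|n IH] f mf f0.
  rewrite integral_dirac// diracT mul1e (bigD1 [tuple]) //= big_nil mul1e.
  rewrite big1 ?adde0 => [|w]; last by rewrite tuple0 => /eqP.
  by congr (f _); apply: val_inj.
have mfc : measurable_fun setT (f \o @cons_pair _ Z n).
  by apply: measurableT_comp => //; exact: measurable_cons_pair.
have fc0 z : 0 <= (f \o @cons_pair _ Z n) z by exact: f0.
rewrite ge0_integral_distribution// (@fubini_tonelli1 _ _ _ _ _ P (sample_law P n))//.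
have E z : \int[sample_law P n]_y (f \o @cons_pair _ Z n) (z, y) =
    \sum_(w : n.-tuple I) (\prod_(i <- w) q i)%:E * f (cons_pair (z, map_tuple x w)).
  rewrite IH//; first exact: (measurable_fun_pair2 z mfc).
rewrite Pq.
- rewrite (big_tuple_cons _ _ GRing.add); apply: eq_bigr => i _.
  rewrite /fubini_F E ge0_sume_distrr; last first.
    by move=> w _; rewrite mule_ge0// lee_fin prodr_ge0.
  apply: eq_bigr => w _; rewrite muleA -EFinM big_cons.
  by congr (_ * f _); apply: val_inj.
- exact: measurable_fun_fubini_tonelli_F.
- by move=> z; exact: integral_ge0.
Qed.

End finitely_supported_law.

(** * The grid law as a member of the margin class *)

Section two_level_law.
Context {R : realType} {d : measure_display} {T : measurableType d} {D k : nat}.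
Context (h : R) (x : 'I_D * 'I_k.+1 -> T).
Context (h01 : 0 < h < 1).
Context (th : {ffun 'I_D -> 'I_k.+1}) (A : set T).
Context (mA : measurable A) (Ax : forall i, (x i \in A) = selected th i).

Definition labelled (o : 'I_D * 'I_k.+1 * bool) : T * bool := (x o.1, o.2).

Context (P : probability (T * bool)%type R).
Context (PE : finitely_supported P (weight h th) labelled).

(** The margin condition bears on every point of [T], including those of mass zero, so this version
    follows [A] on the whole space and not only on the grid. *)
Definition two_level_eta (y : T) : R := if y \in A then (1 + h) / 2 else (1 - h) / 2.

Lemma measurable_two_level_eta : measurable_fun setT two_level_eta.
Proof.
apply: measurable_fun_ifT => //.
apply: (measurable_fun_bool true); rewrite setTI.
rewrite (_ : _ @^-1` _ = A)//; apply/seteqP; split => y /=; [exact: set_mem|exact: mem_set].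
Qed.

Lemma bayes_two_level_eta : bayes two_level_eta = (fun y => y \in A).
Proof.
case/andP: h01 => h0 h1; apply/funext => y; rewrite /bayes /two_level_eta.
by case: (y \in A); apply/idP/idP => //; lra.
Qed.

Lemma sum_weightE (F : 'I_D * 'I_k.+1 -> bool -> R) :
  \sum_o weight h th o * F o.1 o.2 =
  (D * k.+1)%:R^-1 * \sum_i ((1 + h) / 2 * F i (selected th i)
    + (1 - h) / 2 * F i (~~ selected th i)).
Proof.
rewrite -(pair_big xpredT xpredT (fun i b => weight h th (i, b) * F i b)) /= mulr_sumr.
apply: eq_bigr => i _; rewrite big_bool /weight /label_weight /=.
by case: selected => /=; ring.
Qed.

(** Both sides of the defining identity become finite sums over the grid, and agree term by term
    because [A] meets the grid exactly in the selected points. *)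
Lemma regression_function_two_level : regression_function P two_level_eta.
Proof.
case/andP: h01 => h0 h1.
have eta01 y : 0 <= two_level_eta y <= 1.
  by rewrite /two_level_eta; case: ifP => _; lra.
split=> //; first exact: measurable_two_level_eta.
move=> B mB.
have mB1 : measurable [set z : T * bool | B z.1].
  rewrite (_ : [set z | _] = B `*` setT); first exact: measurableX.
  by apply/seteqP; split => z /=; [|case].
rewrite integral_mkcond (PE (_ \_ _)); last 2 first.
- apply/(measurable_restrictT _ mB1); apply: measurable_funTS.
  apply/measurable_EFinP; apply: (measurableT_comp measurable_two_level_eta).
  exact: measurable_fst.
- by move=> z; rewrite patchE; case: ifP => // _; rewrite lee_fin; case/andP: (eta01 z.1).
rewrite (finitely_supportedE _ _ _ _ PE); last first.
  rewrite (_ : [set z | _] = B `*` [set true]); first exact: measurableX.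
  by apply/seteqP; split => z /=; case=> ? ->.
rewrite (eq_bigr (fun o => (weight h th o *
    ((x o.1 \in B)%:R * two_level_eta (x o.1)))%:E)) => [|o _]; last first.
  rewrite [in RHS]EFinM patchE; congr (_ * _)%E.
  have -> : (labelled o \in [set z : T * bool | B z.1]) = (x o.1 \in B).
    by apply/idP/idP; rewrite !inE.
  by case: ifP; rewrite ?mul1r ?mul0r.
rewrite sumEFin (sum_weightE (fun i _ => (x i \in B)%:R * two_level_eta (x i))).
rewrite (eq_bigr (fun o => weight h th o * ((x o.1 \in B) && o.2)%:R)) => [|o _]; last first.
  congr (_ * _%:R); congr nat_of_bool.
  by apply/idP/andP; rewrite !inE.
rewrite (sum_weightE (fun i b => ((x i \in B) && b)%:R)).
congr (_ * _)%:E; apply: eq_bigr => i _.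
rewrite /two_level_eta Ax; case: (x i \in B); case: selected => /=; lra.
Qed.

Lemma margin_class_two_level (calA : set (set T)) : calA A ->
  margin_class h (indicator_class calA) P two_level_eta.
Proof.
case/andP: h01 => h0 h1 cA; split; first exact: regression_function_two_level.
  move=> y; rewrite /two_level_eta; case: ifP => _.
    by rewrite ger0_norm; lra.
  by rewrite ler0_norm; lra.
by exists A; rewrite ?bayes_two_level_eta.
Qed.

Lemma error_two_level B : measurable B ->
  error P (fun y => y \in B) =
  (\sum_o weight h th o * (o.2 != (x o.1 \in B))%:R)%:E.
Proof.
move=> mB; rewrite /error (finitely_supportedE _ _ _ _ PE).
  congr (_%:E); apply: eq_bigr => o _; congr (_ * _%:R); congr nat_of_bool.
  by apply/idP/idP; rewrite inE.
rewrite (_ : [set z | _] = (B `*` [set false]) `|` (~` B `*` [set true])).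
  by apply: measurableU; apply: measurableX => //; exact: measurableC.
apply/seteqP; split => -[y b] /=.
  have [/set_mem yB|/negP yB] := boolP (y \in B); case: b => //= _; first by left.
  by right; split => // /mem_set.
by case=> -[yB ->]; [rewrite mem_set|rewrite memNset].
Qed.

(** Misclassifying a grid point raises its conditional error from [(1 - h) / 2] to [(1 + h) / 2], an
    excess of [h]. *)
Lemma loss_two_level B : measurable B ->
  loss P (bayes two_level_eta) (fun y => y \in B) =
  (finite_loss h th (fun i => x i \in B))%:E.
Proof.
move=> mB; rewrite /loss bayes_two_level_eta !error_two_level// -EFinB; congr (_%:E).
rewrite (sum_weightE (fun i b => (b != (x i \in B))%:R)).
rewrite (sum_weightE (fun i b => (b != (x i \in A))%:R)).
rewrite -mulrBr -sumrB /finite_loss -mulrA; congr (_ * _).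
rewrite mulr_sumr; apply: eq_bigr => i _; rewrite Ax.
by case: selected; case: (x i \in B) => /=; lra.
Qed.

End two_level_law.

(** * From the finite problem to the minimax risk *)

Lemma minimax_risk_ge (R : realType) (d : measure_display) (T : measurableType d)
    (D k n : nat) (h : R) (calA : set (set T)) (x : 'I_D * 'I_k.+1 -> T) :
  (0 < D)%N -> 0 < h < 1 -> (forall A, calA A -> measurable A) ->
  (forall th : {ffun 'I_D -> 'I_k.+1},
    exists2 A, calA A & forall i, (x i \in A) = selected th i) ->
  (1 + 4 * h ^+ 2 / ((D * k.+1)%:R * (1 - h ^+ 2))) ^+ n <= k.+1%:R / 4 ->
  ((h / (2 * k.+1%:R))%:E <= minimax_risk n h (indicator_class calA))%E.
Proof.
move=> D0 h01 mA xA chi; apply: le_ereal_inf_tmp => _ [shat [Sshat mshat] <-].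
(* An estimator induces a rule for the finite problem: feed it the labelled grid points and read its
   prediction on the grid. *)
pose t (w : n.-tuple ('I_D * 'I_k.+1 * bool)) i := shat (map_tuple (labelled x) w) (x i).
have [th le_th] := finite_lower_bound _ D0 h01 chi t.
have [A cA Ax] := xA th.
have w0 o : 0 <= weight h th o by rewrite ltW // label_weight_gt0.
have [P PE] := finitely_supported_exists _ (labelled x) w0 (sum_weight _ D0 th).
have lossE z : exists2 B, measurable B & shat z = (fun y => y \in B).
  by have [B cB <-] := Sshat z; exists B => //; exact: mA.
apply: (le_trans _ (ereal_sup_ubound _)); last first.
  exists (P, two_level_eta h A) => //=.
  exact: (margin_class_two_level _ x h01 th A (mA _ cA) Ax).
have lossP := loss_two_level _ x h01 th A (mA _ cA) Ax P PE.
rewrite /= (integral_sample_law _ _ _ _ _ PE)//.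
- rewrite (eq_bigr (fun w => (likelihood h th w * finite_loss h th (t w))%:E)).
    by rewrite sumEFin lee_fin.
  move=> w _; rewrite EFinM; congr (_ * _)%E.
  rewrite /t; have [B mB ->] := lossE (map_tuple (labelled x) w).
  by rewrite lossP.
(* Only the error of [shat z] varies with [z], and its measurability is part of [estimator]. *)
- rewrite /loss bayes_two_level_eta//.
  apply: emeasurable_funB => //; exact: mshat.
- move=> z; have [B mB ->] := lossE z.
  rewrite lossP// lee_fin.
  case/andP: h01 => h0 _.
  by rewrite /finite_loss mulr_ge0 ?sumr_ge0// mulr_ge0 ?invr_ge0// ltW.
Qed.

(** The points [(j, th j)], one in each block, form a subset of cardinality [D] among the [D * k.+1]
    points, so the class cuts it out. *)
Lemma property_A_selected (d : measure_display) (T : measurableType d)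
    (D k : nat) (calA : set (set T)) : property_A calA (D * k.+1) D ->
  exists x : 'I_D * 'I_k.+1 -> T, forall th : {ffun 'I_D -> 'I_k.+1},
    exists2 A, calA A & forall i, (x i \in A) = selected th i.
Proof.
have -> : (D * k.+1)%N = #|{: 'I_D * 'I_k.+1}| by rewrite card_prod !card_ord.
case=> x0 x0_inj shatter; pose x i := x0 (enum_rank i).
have x_inj : injective x by move=> i j /x0_inj/enum_rank_inj.
exists x => th; pose g (j : 'I_D) := x (j, th j).
have g_inj : injective g by move=> j j' /x_inj [].
have [|//|A cA AB] := shatter (range g).
- by move=> _ [j _ <-]; exists (enum_rank (j, th j)).
- apply: card_eq_trans (inj_card_eq (in2W g_inj)) _.
  by rewrite card_eq_sym; exact: card_II.
exists A => // i.
have xr : range x0 (x i) by exists (enum_rank i).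
apply/idP/eqP => [/set_mem Ai|thi].
  have : range g (x i) by rewrite -AB; split.
  by case=> j _ /x_inj <-.
apply/mem_set; have : range g (x i) by exists i.1 => //; rewrite /g thi; case: (i).
by rewrite -AB => -[].
Qed.

(** * Choice of the block size and conclusion *)

Lemma block_size_exists (R : realType) (D n : nat) (h : R) :
  (0 < D)%N -> (0 < n)%N -> 0 < h < 1 -> 1 <= n%:R * h ^+ 2 / D%:R ->
  exists k : nat, [/\ (4 <= k.+1)%N,
    (1 + 4 * h ^+ 2 / ((D * k.+1)%:R * (1 - h ^+ 2))) ^+ n <= k.+1%:R / 4 &
    64^-1 * (1 - h) * (D%:R / (n%:R * h)) * (1 + ln (n%:R * h ^+ 2 / D%:R)) <=
      h / (2 * k.+1%:R)].
Proof.
move=> D0 n0 /andP[h0 h1]; set u := n%:R * h ^+ 2 / D%:R => u1.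
have dR : 0 < D%:R :> R by rewrite ltr0n.
have nR : 0 < n%:R :> R by rewrite ltr0n.
have u0 : 0 < u by lra.
pose L := ln u; have L0 : 0 <= L by exact: ln_ge0.
have ln_le (v : R) : 0 < v -> ln v <= v - 1.
  by move=> v0; rewrite -[X in ln X](addrNK 1) addrC le_ln1Dx//; lra.
have Lu : 1 + L <= u by have := ln_le u u0; rewrite -/L; lra.
(* The target order of the block size. As [k] is the integer part of [r], [k.+1] lies in the
   interval from [r] to [2 r]; the factor 16 yields both [k.+1 >= 4] and the bound on [chi]. *)
pose r := 16 * u / ((1 - h) * (1 + L)).
have den0 : 0 < (1 - h) * (1 + L) by apply: mulr_gt0; lra.
have r16 : 16 <= r by rewrite /r ler_pdivlMr//; nra.
pose k := Num.truncn r.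
have /andP[kr rk] : k%:R <= r < k.+1%:R by apply: truncn_itv; lra.
have kr2 : k.+1%:R <= 2 * r by rewrite -natr1; lra.
have K0 : 0 < k.+1%:R :> R by rewrite ltr0n.
exists k; split.
- by rewrite -(ler_nat R); lra.
- have s0 : 0 < Num.sqrt u by rewrite sqrtr_gt0.
  (* Halving the logarithm turns [ln v <= v - 1] into [1 + L <= 2 sqrt u], hence [r >= 8 sqrt u] and
     [k.+1 / 4 >= 2 sqrt u]. *)
  have L2 : L = 2 * ln (Num.sqrt u).
    by rewrite /L -{1}(sqr_sqrtr (ltW u0)) lnXn// mulr2n mulrDl !mul1r.
  have sq : 1 + L <= 2 * Num.sqrt u.
    rewrite L2; have := ln_le _ s0; lra.
  have lnK_ge : (1 + L) / 2 <= ln (k.+1%:R / 4).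
    have K4 : 2 * Num.sqrt u <= k.+1%:R / 4.
      suff : 8 * Num.sqrt u <= r by lra.
      rewrite /r ler_pdivlMr//.
      have den_le : (1 - h) * (1 + L) <= 2 * Num.sqrt u by nra.
      have := ler_wpM2l (ltW s0) den_le.
      have := sqr_sqrtr (ltW u0); rewrite expr2; lra.
    apply: le_trans (_ : ln (2 * Num.sqrt u) <= _); last first.
      by rewrite ler_ln ?posrE ?mulr_gt0 ?divr_gt0.
    rewrite lnM ?posrE// -[in ln 2](invrK 2) lnV ?posrE ?invr_gt0//.
    (* This gives [ln 2 >= 1 / 2], which with [ln (sqrt u) = L / 2] makes up [(1 + L) / 2]. *)
    have := ln_le 2^-1; lra.
  have -> : k.+1%:R / 4 = expR (ln (k.+1%:R / 4)) :> R by rewrite lnK// posrE divr_gt0.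
  set y := (_ / (_ * (1 - _))).
  have y0 : 0 <= y by rewrite /y divr_ge0 ?mulr_ge0 ?sqr_ge0//; nra.
  (* Since [1 + y <= exp y], it suffices that [n y <= (1 + L) / 2]. *)
  apply: (@le_trans _ _ (expR y ^+ n)).
    by apply: lerXn2r; rewrite ?nnegrE ?expR_ge0 ?expR_ge1Dx//; lra.
  rewrite -expRM_natl ler_expR; apply: le_trans lnK_ge.
  have -> : n%:R * y = 4 * u / (k.+1%:R * (1 - h ^+ 2)).
    rewrite /y /u natrM; move: (k.+1%:R) K0 => K K0.
    by field; rewrite !gt_eqF//; nra.
  rewrite ler_pdivrMr; last by rewrite mulr_gt0//; nra.
  have : 16 * u <= k.+1%:R * ((1 - h) * (1 + L)) by rewrite -ler_pdivrMr// ltW.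
  have : 0 <= k.+1%:R * (1 - h) * (1 + L) * h by rewrite !mulr_ge0//; lra.
  by nra.
(* Replacing [k.+1] by its upper bound [2 r] turns the inequality into an equality: the constant 64
   is [2 * 2 * 16]. *)
- rewrite ler_pdivlMr ?mulr_gt0//.
  apply: (@le_trans _ _ (64^-1 * (1 - h) * (D%:R / (n%:R * h)) * (1 + L) * (2 * (2 * r)))).
    apply: ler_wpM2l; last by lra.
    by rewrite -/L !mulr_ge0// ?invr_ge0 ?mulr_ge0//; lra.
  rewrite le_eqVlt; apply/orP; left; apply/eqP.
  have l1 : 0 < 1 + L by lra.
  rewrite /r; move: (1 + L) l1 => M M0; rewrite /u; field.
  by rewrite !gt_eqF//; lra.
Qed.

Theorem theorem5 (R : realType) :
  exists2 c : R, 0 < c &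
    forall (d : measure_display) (T : measurableType d) (D n : nat)
      (calA : set (set T)) (h : R),
      (1 <= D)%N -> (1 <= n)%N ->
      (forall A, calA A -> measurable A) ->
      (forall N : nat, (4 * D <= N)%N -> property_A calA N D) ->
      0 <= h < 1 ->
      Num.sqrt (D%:R / n%:R) <= h ->
      ((c * (1 - h) * (D%:R / (n%:R * h)) * (1 + ln (n%:R * h ^+ 2 / D%:R)))%:E
        <= minimax_risk n h (indicator_class calA))%E.
Proof.
exists 64^-1 => [|d T D n calA h D0 n0 mA shatter /andP[_ h1] sqrt_h]; first by lra.
have dR : 0 < D%:R :> R by rewrite ltr0n.
have nR : 0 < n%:R :> R by rewrite ltr0n.
have h0 : 0 < h by apply: lt_le_trans sqrt_h; rewrite sqrtr_gt0 divr_gt0.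
have h01 : 0 < h < 1 by rewrite h0.
(* The square of the hypothesis on [h]; it makes the logarithm nonnegative. *)
have u1 : 1 <= n%:R * h ^+ 2 / D%:R.
  rewrite ler_pdivlMr// mul1r mulrC -ler_pdivrMr//.
  by rewrite -[leLHS]sqr_sqrtr ?divr_ge0// lerXn2r// ?nnegrE ?sqrtr_ge0// ltW.
have [k [k4 chi ck]] := block_size_exists _ _ _ _ D0 n0 h01 u1.
have [|x xA] := @property_A_selected _ T D k calA.
  (* The shattering hypothesis is used for [N = D * k.+1], which is at least [4 * D] because
     [k.+1 >= 4]. *)
  by apply: shatter; rewrite mulnC leq_pmul2l.
by apply: le_trans (minimax_risk_ge _ _ _ _ _ _ _ _ _ D0 h01 mA xA chi); rewrite lee_fin.
Qed.
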